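(* If $(X,d)$ is a proper metric space, then the boundary $\mathcal{U}_{{\bf b}_d}X$ of the metric coarse proximity space $(X,\mathcal{B}_d,{\bf b}_d)$ is homeomorphic to the Higson corona $\nu X$.
   Context: A metric space is proper if its closed bounded subsets are compact. Coarse proximity spaces. A bornology $\mathcal{B}$ on a set $X$ is a family of subsets containing all singletons and closed under subsets and finite unions; its members are called bounded. A coarse proximity on $(X,\mathcal{B})$ is a relation ${\bf b}$ on the power set of $X$ such that for all $A,B,C\subseteq X$: (1) $A{\bf b}B\Rightarrow B{\bf b}A$; (2) $A{\bf b}B\Rightarrow A,B\notin\mathcal{B}$; (3) $A\cap B\notin\mathcal{B}\Rightarrow A{\bf b}B$; (4) $(A\cup B){\bf b}C\iff A{\bf b}C$ or $B{\bf b}C$; (5) $A\bar{\bf b}B\Rightarrow\exists E\subseteq X$ with $A\bar{\bf b}E$ and $(X\setminus E)\bar{\bf b}B$ (a bar denotes negation). Then $(X,\mathcal{B},{\bf b})$ is a coarse proximity space. The metric coarse proximity space of $(X,d)$ is $(X,\mathcal{B}_d,{\bf b}_d)$, where $\mathcal{B}_d$ is the collection of metrically bounded sets and $A{\bf b}_dB$ iff there is $\epsilon<\infty$ such that for every bounded set $D$ there are $a\in A\setminus D$ and $b\in B\setminus D$ with $d(a,b)<\epsilon$; this is a coarse proximity space. Proximities and clusters. A proximity on a set $X$ is a relation $\delta$ on the power set with: (1) $A\delta B\Rightarrow B\delta A$; (2) $A\delta B\Rightarrow A,B\ne\emptyset$; (3) $A\cap B\neq\emptyset\Rightarrow A\delta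 B$; (4) $A\delta(B\cup C)\iff A\delta B$ or $A\delta C$; (5) $A\bar\delta B\Rightarrow\exists E\subseteq X$ with $A\bar\delta E$ and $(X\setminus E)\bar\delta B$. It is separated if $\{x\}\delta\{y\}\iff x=y$. It induces the topology in which $A$ is closed iff ($A\delta\{x\}\Rightarrow x\in A$). A cluster in $(X,\delta)$ is a collection $\sigma$ of subsets of $X$ such that: $A,B\in\sigma\Rightarrow A\delta B$; if $A\delta B$ for all $B\in\sigma$ then $A\in\sigma$; if $A\cup B\in\sigma$ then $A\in\sigma$ or $B\in\sigma$. For $\delta$ separated, the Smirnov compactification $\mathfrak{X}$ is the set of all clusters with the proximity $\mathcal{A}\delta^*\mathcal{C}$ iff $A\delta C$ for all $A,C\subseteq X$ such that $A\in\sigma$ for all $\sigma\in\mathcal{A}$ and $C\in\sigma$ for all $\sigma\in\mathcal{C}$; it is compact Hausdorff, and $X$ is identified with a dense subset of $\mathfrak{X}$ via $x\mapsto\sigma_x$, the unique cluster containing $\{x\}$. Higson corona. For a proper metric space $(X,d)$, the Higson proximity is the separated proximity $A\delta_HB\iff d(A,B)=0$ or $A{\bf b}_dB$, where $d(A,B)=\inf\{d(a,b)\mid a\in A,b\in B\}$ ($=\infty$ if $A$ or $B$ is empty). The Higson compactification $hX$ is the Smirnov compactification of $(X,\delta_H)$, and the Higson corona is $\nu X=hX\setminus X$ with the subspace topology. Boundary. For a coarse proximity space $(X,\mathcal{B},{\bf b})$, the discrete extension is the separated proximity $A\delta_{dis}B\iff A\cap B\ne\emptyset$ or $A{\bf b}B$.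 The boundary $\mathcal{U}_{\bf b}X$ is the set of clusters in $(X,\delta_{dis})$ containing no bounded set, with the topology inherited from the Smirnov compactification of $(X,\delta_{dis})$. *)

(* Defs.v *)
From HB Require Import structures.
From mathcomp Require Import all_boot all_order all_algebra.
From mathcomp Require Import all_classical all_reals all_analysis.
From mathcomp Require Import lra.
Set Implicit Arguments.
Unset Strict Implicit.
Unset Printing Implicit Defensive.
Import Order.TTheory GRing.Theory Num.Theory.
Local Open Scope classical_set_scope.
Local Open Scope ring_scope.

Definition homeomorphic (S T : topologicalType) : Prop :=
  exists (f : S -> T) (g : T -> S),
    [/\ cancel f g, cancel g f, continuous f & continuous g].

Record proximity (X : Type) := Proximity {
  prox :> set X -> set X -> Prop;
  prox_sym : forall A B, prox A B -> prox B A;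
  prox_neq0 : forall A B, prox A B -> A !=set0 /\ B !=set0;
  prox_meet : forall A B, A `&` B !=set0 -> prox A B;
  prox_setU : forall A B C, prox A (B `|` C) <-> prox A B \/ prox A C;
  prox_split : forall A B, ~ prox A B ->
    exists E, ~ prox A E /\ ~ prox (~` E) B }.

Definition separated_proximity (X : Type) (delta : proximity X) : Prop :=
  forall x y : X, delta [set x] [set y] <-> x = y.

(* the closed sets of the topology induced by delta *)
Definition prox_closed (X : Type) (delta : proximity X) (A : set X) : Prop :=
  forall x, delta A [set x] -> A x.

Definition prox_open (X : Type) (delta : proximity X) : set (set X) :=
  [set A | prox_closed delta (~` A)].

Section proximity_theory.
Context (X : Type) (delta : proximity X).

Lemma prox_subr (A B C : set X) : B `<=` C -> delta A B -> delta A C.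
Proof. by move=> /setUidPr <- AB; apply/prox_setU; left. Qed.

Lemma prox_subl (A B C : set X) : A `<=` B -> delta A C -> delta B C.
Proof. by move=> AB /prox_sym h; apply/prox_sym/(prox_subr AB). Qed.

Lemma prox_setUl (A B C : set X) :
  delta (A `|` B) C -> delta A C \/ delta B C.
Proof. by move=> /prox_sym/prox_setU[] /prox_sym; [left|right]. Qed.

Lemma prox_openT : prox_open delta setT.
Proof. by move=> x; rewrite setCT => /prox_neq0[[]]. Qed.

Lemma prox_openI : setI_closed (prox_open delta).
Proof.
move=> A B oA oB x; rewrite setCI => /prox_setUl[/oA|/oB]; by [left|right].
Qed.

Lemma prox_open_bigU (I : Type) (f : I -> set X) :
  (forall i, prox_open delta (f i)) -> prox_open delta (\bigcup_i f i).
Proof.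
move=> of_ x dx [i _ fix_]; apply: (of_ i x) => //; apply: prox_subl dx.
by apply: subsetC => y fy; exists i.
Qed.

End proximity_theory.

Record cluster (X : Type) (delta : proximity X) := Cluster {
  cluster_set :> set X -> Prop;
  cluster_near : forall A B, cluster_set A -> cluster_set B -> delta A B;
  cluster_max : forall A, (forall B, cluster_set B -> delta A B) ->
    cluster_set A;
  cluster_setU : forall A B, cluster_set (A `|` B) ->
    cluster_set A \/ cluster_set B }.

HB.instance Definition _ (X : Type) (delta : proximity X) :=
  gen_eqMixin (cluster delta).
HB.instance Definition _ (X : Type) (delta : proximity X) :=
  gen_choiceMixin (cluster delta).

Section cluster_theory.
Context (X : Type) (delta : proximity X).
Implicit Types (s t : cluster delta) (A B E : set X).
Implicit Types F G H : set (cluster delta).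

Lemma clusterP s t : (forall A, s A <-> t A) -> s = t.
Proof.
case: s t => [s s1 s2 s3] [t t1 t2 t3] /= st.
have {}st : s = t by apply/funext => A; apply/propext.
by case: t / st t1 t2 t3 => *; congr Cluster; exact: Prop_irrelevance.
Qed.

Lemma clusterS s A B : A `<=` B -> s A -> s B.
Proof.
move=> AB sA; apply: cluster_max => C sC; apply: prox_subl AB _.
exact: cluster_near sC.
Qed.

Lemma cluster_nset0 s A : s A -> A !=set0.
Proof. by move=> sA; have /prox_neq0[] := cluster_near sA sA. Qed.

Lemma clusterT s : s setT.
Proof.
apply: cluster_max => B sB; apply: prox_meet; rewrite setTI.
exact: cluster_nset0 sB.
Qed.

Lemma clusterC s E : ~ s E -> s (~` E).
Proof.
by move=> nE; have := clusterT s; rewrite -(setUv E) => /cluster_setU[].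
Qed.

Definition absorbs (A : set X) F : Prop := forall s, F s -> s A.

Definition smirnov_rel F G : Prop :=
  forall A C, absorbs A F -> absorbs C G -> delta A C.

Lemma smirnov_sym F G : smirnov_rel F G -> smirnov_rel G F.
Proof. by move=> FG A C AG CF; apply: prox_sym; exact: FG. Qed.

Lemma smirnov_neq0 F G : smirnov_rel F G -> F !=set0 /\ G !=set0.
Proof.
suff aux F' G' : smirnov_rel F' G' -> F' !=set0.
  by move=> FG; split; [exact: aux FG|exact: aux (smirnov_sym FG)].
move=> FG; apply/set0P/negP => /eqP F0.
have /prox_neq0[[]//] : delta set0 setT.
apply: FG => [s|s _]; last exact: clusterT.
by rewrite F0.
Qed.

Lemma smirnov_meet F G : F `&` G !=set0 -> smirnov_rel F G.
Proof.
move=> [s [Fs Gs]] A C AF CG.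
by apply: (@cluster_near _ _ s); [exact: AF|exact: CG].
Qed.

Lemma not_smirnov_rel F G : ~ smirnov_rel F G ->
  exists A C, [/\ absorbs A F, absorbs C G & ~ delta A C].
Proof.
move=> nFG; apply: contrapT => h; apply: nFG => A C AF CG.
by apply: contrapT => n; apply: h; exists A, C.
Qed.

Lemma smirnov_setU F G H :
  smirnov_rel F (G `|` H) <-> smirnov_rel F G \/ smirnov_rel F H.
Proof.
split; last first.
  by move=> [FG|FH] A C AF CGH; [apply: FG|apply: FH] => // s sG;
    apply: CGH; [left|right].
move=> FGH; apply: contrapT => /not_orP[nG nH].
have [A [C [AF CG nAC]]] := not_smirnov_rel nG.
have [B [D [BF DH nBD]]] := not_smirnov_rel nH.
have [E [nAE nEC]] := prox_split nAC.
have [E' [nBE nED]] := prox_split nBD.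
have : delta (~` (E `|` E')) (C `|` D).
  apply: FGH => s.
    move=> Fs; apply: clusterC => /cluster_setU[sE|sE'].
      by apply: nAE; apply: (@cluster_near _ _ s) => //; exact: AF.
    by apply: nBE; apply: (@cluster_near _ _ s) => //; exact: BF.
  by move=> [/CG|/DH]; apply: clusterS => x; [left|right].
move=> /prox_setU[]; rewrite setCU.
  by move=> h; apply: nEC; apply: prox_subl h => x [].
by move=> h; apply: nED; apply: prox_subl h => x [].
Qed.

Lemma smirnov_split F G : ~ smirnov_rel F G ->
  exists H, ~ smirnov_rel F H /\ ~ smirnov_rel (~` H) G.
Proof.
move=> /not_smirnov_rel[A [C [AF CG nAC]]].
have [E [nAE nEC]] := prox_split nAC.
exists [set s | s E]; split => h.
  by apply: nAE; apply: h => // s.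
by apply: nEC; apply: h => // s /clusterC.
Qed.

Definition smirnov_proximity : proximity (cluster delta) :=
  Proximity smirnov_sym smirnov_neq0 smirnov_meet smirnov_setU smirnov_split.

Lemma point_near (x : X) A B :
  delta A [set x] -> delta B [set x] -> delta A B.
Proof.
move=> Ax Bx; apply: contrapT => /prox_split[E [nAE nEB]].
have [Ex|nEx] := pselect (E x).
  by apply: nAE; apply: prox_subr Ax => _ ->.
by apply: nEB; apply: prox_sym; apply: prox_subr Bx => _ ->.
Qed.

Lemma point_max (x : X) A :
  (forall B, delta B [set x] -> delta A B) -> delta A [set x].
Proof. by apply; apply: prox_meet; exists x. Qed.

(* sigma_x; see point_cluster_unique *)
Definition point_cluster (x : X) : cluster delta :=
  @Cluster X delta [set A | delta A [set x]] (@point_near x) (@point_max x)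
    (fun A B => @prox_setUl X delta A B [set x]).

Lemma point_cluster_unique (x : X) s : s [set x] <-> s = point_cluster x.
Proof.
split=> [sx|->]; last by apply: prox_meet; exists x.
apply: clusterP => A; split=> [sA|Ax]; first exact: cluster_near sA sx.
apply: cluster_max => B sB; apply: point_near Ax _.
exact: cluster_near sB sx.
Qed.

End cluster_theory.

(* [cluster delta] with the topology induced by [smirnov_proximity delta]; the
   construction does not need separatedness, which [discrete_extension] and
   [higson_proximity] are shown to have below. *)
Definition smirnov (X : Type) (delta : proximity X) : Type := cluster delta.

HB.instance Definition _ (X : Type) (delta : proximity X) :=
  Choice.on (smirnov delta).
HB.instance Definition _ (X : Type) (delta : proximity X) :=
  isOpenTopological.Build (smirnov delta)
    (@prox_openT _ (smirnov_proximity delta))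
    (@prox_openI _ (smirnov_proximity delta))
    (@prox_open_bigU _ (smirnov_proximity delta)).

Record bornology (X : Type) := Bornology {
  bounded_sets :> set X -> Prop;
  bounded1 : forall x, bounded_sets [set x];
  (* the empty union; it follows from the other fields unless X is empty *)
  bounded0 : bounded_sets set0;
  bounded_sub : forall A B, A `<=` B -> bounded_sets B -> bounded_sets A;
  boundedU : forall A B, bounded_sets A -> bounded_sets B ->
    bounded_sets (A `|` B) }.

Record coarse_proximity (X : Type) (Bd : bornology X) := CoarseProximity {
  cprox :> set X -> set X -> Prop;
  cprox_sym : forall A B, cprox A B -> cprox B A;
  cprox_unbounded : forall A B, cprox A B -> ~ Bd A /\ ~ Bd B;
  cprox_meet : forall A B, ~ Bd (A `&` B) -> cprox A B;
  cprox_setU : forall A B C, cprox (A `|` B) C <-> cprox A C \/ cprox B C;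
  cprox_split : forall A B, ~ cprox A B ->
    exists E, ~ cprox A E /\ ~ cprox (~` E) B }.

Section discrete_extension.
Context (X : Type) (Bd : bornology X) (b : coarse_proximity Bd).
Implicit Types A B C : set X.

Definition discrete_rel A B : Prop := A `&` B !=set0 \/ b A B.

Lemma cprox_subl A B C : A `<=` B -> b A C -> b B C.
Proof. by move=> /setUidPr <- AC; apply/cprox_setU; left. Qed.

Lemma cprox_subr A B C : B `<=` C -> b A B -> b A C.
Proof. by move=> BC /cprox_sym h; apply/cprox_sym/(cprox_subl BC). Qed.

Lemma cprox_setUr A B C : b A (B `|` C) <-> b A B \/ b A C.
Proof.
split=> [/cprox_sym/cprox_setU[] /cprox_sym|[]]; first by left.
- by right.
- by apply: cprox_subr => x; left.
- by apply: cprox_subr => x; right.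
Qed.

Lemma cprox_neq0 A B : b A B -> A !=set0 /\ B !=set0.
Proof.
move=> /cprox_unbounded[nA nB]; split; apply/set0P/negP => /eqP E0.
- by apply: nA; rewrite E0; exact: bounded0.
- by apply: nB; rewrite E0; exact: bounded0.
Qed.

Lemma discrete_sym A B : discrete_rel A B -> discrete_rel B A.
Proof. by move=> [|/cprox_sym]; [rewrite setIC; left|right]. Qed.

Lemma discrete_neq0 A B : discrete_rel A B -> A !=set0 /\ B !=set0.
Proof. by move=> [[x [Ax Bx]]|/cprox_neq0//]; split; exists x. Qed.

Lemma discrete_meet A B : A `&` B !=set0 -> discrete_rel A B.
Proof. by left. Qed.

Lemma discrete_setU A B C :
  discrete_rel A (B `|` C) <-> discrete_rel A B \/ discrete_rel A C.
Proof.
split.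
- move=> [[x [Ax [Bx|Cx]]]|/cprox_setUr[h|h]].
  + by left; left; exists x.
  + by right; left; exists x.
  + by left; right.
  + by right; right.
- move=> [[[x [Ax Bx]]|h]|[[x [Ax Bx]]|h]].
  + by left; exists x; split => //; left.
  + by right; apply/cprox_setUr; left.
  + by left; exists x; split => //; right.
  + by right; apply/cprox_setUr; right.
Qed.

Lemma discrete_split A B : ~ discrete_rel A B ->
  exists E, ~ discrete_rel A E /\ ~ discrete_rel (~` E) B.
Proof.
move=> /not_orP[nI nb]; have [E [nAE nEB]] := cprox_split nb.
exists ((E `|` B) `\` A); split.
- move=> [[x [Ax [_]]]//|h].
  have : b A (E `|` B) by apply: cprox_subr h => x [].
  by move=> /cprox_setUr[].
- move=> [[x [nE Bx]]|h].
  + by apply: nE; split; [right|move=> Ax; apply: nI; exists x].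
  + have : b (~` E `|` A) B.
      apply: cprox_subl h => x nE.
      have [Ax|nAx] := pselect (A x); first by right.
      by left=> Ex; apply: nE; split => //; left.
    by move=> /cprox_setU[].
Qed.

Definition discrete_extension : proximity X :=
  Proximity discrete_sym discrete_neq0 discrete_meet discrete_setU
    discrete_split.

Lemma discrete_extension_separated : separated_proximity discrete_extension.
Proof.
move=> x y; split=> [[[z [-> ->]]//|/cprox_unbounded[nx _]]|->].
- by case: nx; exact: bounded1.
- by left; exists y.
Qed.

Definition boundary_set : set (smirnov discrete_extension) :=
  [set s | forall A : set X, s A -> ~ Bd A].

Definition boundary : topologicalType := set_type boundary_set.

End discrete_extension.

Section metric.
Context (R : realType) (X : metricType R).
Implicit Types (x y : X) (A B C D E : set X).

Definition metric_bounded : set (set X) :=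
  [set A | exists M : R, forall x y, A x -> A y -> mdist x y <= M].

Definition proper_space : Prop :=
  forall A, closed A -> metric_bounded A -> compact A.

Lemma metric_bounded1 x : metric_bounded [set x].
Proof. by exists 0 => _ _ -> ->; rewrite mdistxx. Qed.

Lemma metric_bounded0 : metric_bounded set0.
Proof. by exists 0. Qed.

Lemma metric_bounded_sub A B :
  A `<=` B -> metric_bounded B -> metric_bounded A.
Proof. by move=> AB [M BM]; exists M => x y /AB Bx /AB By; exact: BM. Qed.

Lemma metric_boundedU A B :
  metric_bounded A -> metric_bounded B -> metric_bounded (A `|` B).
Proof.
move=> [M AM] [N BN].
have [[a Aa]|nA] := pselect (A !=set0); last first.
  by exists N => x y [Ax|Bx] [Ay|By];
    [case: nA; exists x|case: nA; exists x|case: nA; exists y|exact: BN].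
have [[b Bb]|nB] := pselect (B !=set0); last first.
  by exists M => x y [Ax|Bx] [Ay|By];
    [exact: AM|case: nB; exists y|case: nB; exists x|
     case: nB; exists x].
have M0 : 0 <= M by apply: le_trans (AM _ _ Aa Aa); exact: mdist_ge0.
have N0 : 0 <= N by apply: le_trans (BN _ _ Bb Bb); exact: mdist_ge0.
have d0 : 0 <= mdist a b by exact: mdist_ge0.
exists (M + mdist a b + N) => x y [Ax|Bx] [Ay|By].
- by have := AM _ _ Ax Ay; lra.
- have := AM _ _ Ax Aa; have := BN _ _ Bb By.
  have := metric_triangle x a y; have := metric_triangle a b y; lra.
- have := AM _ _ Aa Ay; have := BN _ _ Bx Bb; have := metric_sym a b.
  have := metric_triangle x b y; have := metric_triangle b a y; lra.
- by have := BN _ _ Bx By; lra.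
Qed.

Definition metric_bornology : bornology X :=
  Bornology metric_bounded1 metric_bounded0 metric_bounded_sub metric_boundedU.

Definition metric_coarse_rel A B : Prop :=
  exists eps : R, forall D, metric_bounded D ->
    exists a b, [/\ (A `\` D) a, (B `\` D) b & mdist a b < eps].

Lemma metric_bounded_thicken D (e : R) : metric_bounded D ->
  metric_bounded [set x | exists2 y, D y & mdist x y < e].
Proof.
move=> [M DM]; exists (e + M + e) => x x' [y Dy xy] [y' Dy' xy'].
have := DM _ _ Dy Dy'; have := metric_triangle x y x'.
by have := metric_triangle y y' x'; have := metric_sym x' y'; lra.
Qed.

Lemma metric_coarse_sym A B : metric_coarse_rel A B -> metric_coarse_rel B A.
Proof.
move=> [e h]; exists e => D /h[a [b [? ? ab]]].
by exists b, a; split => //; rewrite metric_sym.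
Qed.

Lemma metric_coarse_unbounded A B : metric_coarse_rel A B ->
  ~ metric_bornology A /\ ~ metric_bornology B.
Proof. by move=> [e h]; split => /h[a [b [[? ?] [? ?] _]]]. Qed.

Lemma metric_coarse_meet A B :
  ~ metric_bornology (A `&` B) -> metric_coarse_rel A B.
Proof.
move=> nAB; exists 1 => D bD; apply: contrapT => n; apply: nAB.
apply: metric_bounded_sub bD => x [Ax Bx]; apply: contrapT => nDx; apply: n.
by exists x, x; split => //; rewrite mdistxx.
Qed.

Lemma metric_coarse_setU A B C : metric_coarse_rel (A `|` B) C <->
  metric_coarse_rel A C \/ metric_coarse_rel B C.
Proof.
split; last first.
  move=> [[e h]|[e h]]; exists e => D /h[a [b [[Fa Da] ? ?]]]; exists a, b.
    by split => //; split => //; left.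
  by split => //; split => //; right.
move=> [e h]; apply: contrapT => /not_orP[nA nB].
have aux F : ~ metric_coarse_rel F C -> exists2 D, metric_bounded D &
    forall a b, (F `\` D) a -> (C `\` D) b -> ~ mdist a b < e.
  move=> nF; apply: contrapT => n; apply: nF; exists e => D bD.
  apply: contrapT => n'; apply: n; exists D => // a b Fa Cb ab.
  by apply: n'; exists a, b.
have [D bD hD] := aux _ nA; have [E bE hE] := aux _ nB.
have [a [b [[Fa /not_orP[nDa nEa]] [Cb /not_orP[nDb nEb]] ab]]] :=
  h _ (metric_boundedU bD bE).
by case: Fa => Fa; [apply: (hD a b)|apply: (hE a b)].
Qed.

(* the points at least as close to B as to A: it witnesses the splitting
   axiom both at infinity and at distance 0 *)
Let closer A B : set X :=
  [set x | forall a, A a -> exists2 b, B b & mdist x b <= mdist x a].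

Let closerP A B a x (e : R) : A a -> closer A B x -> mdist a x < e ->
  exists b, [/\ B b, mdist x b < e & mdist a b < e + e].
Proof.
move=> Aa /(_ _ Aa)[b Bb xb]; rewrite metric_sym => xa.
exists b; have := metric_triangle a x b; have := metric_sym a x.
by split => //; lra.
Qed.

Let closerCP A B b x (e : R) : B b -> (~` closer A B) x -> mdist x b < e ->
  exists a, [/\ A a, mdist x a < e & mdist a b < e + e].
Proof.
move=> Bb nx xb.
have [a Aa h] : exists2 a, A a & mdist x a < mdist x b.
  apply: contrapT => n; apply: nx => a Aa; exists b => //.
  by rewrite leNgt; apply/negP => h; apply: n; exists a.
exists a; have := metric_triangle a x b; have := metric_sym a x.
by split => //; lra.
Qed.

Let closer_coarse A B : ~ metric_coarse_rel A B ->
  ~ metric_coarse_rel A (closer A B) /\ ~ metric_coarse_rel (~` closer A B) B.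
Proof.
move=> nAB; split=> -[e h]; apply: nAB; exists (e + e) => D bD.
- have [a [x [[Aa nDa] [Ex nDx] ax]]] :=
    h _ (metric_boundedU bD (metric_bounded_thicken e bD)).
  have [b [Bb xb ab]] := closerP Aa Ex ax.
  exists a, b; split => //; split => //; first by move=> Da; apply: nDa; left.
  by move=> Db; apply: nDx; right; exists b.
- have [x [b [[Ex nDx] [Bb nDb] xb]]] :=
    h _ (metric_boundedU bD (metric_bounded_thicken e bD)).
  have [a [Aa xa ab]] := closerCP Bb Ex xb.
  exists a, b; split => //; split => //; last by move=> Db; apply: nDb; left.
  by move=> Da; apply: nDx; right; exists a.
Qed.

Lemma metric_coarse_split A B : ~ metric_coarse_rel A B ->
  exists E, ~ metric_coarse_rel A E /\ ~ metric_coarse_rel (~` E) B.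
Proof. by move=> /closer_coarse; exists (closer A B). Qed.

Definition metric_coarse_proximity : coarse_proximity metric_bornology :=
  CoarseProximity metric_coarse_sym metric_coarse_unbounded metric_coarse_meet
    metric_coarse_setU metric_coarse_split.

Definition set_dist A B : \bar R :=
  ereal_inf [set (mdist a b)%:E | a in A & b in B].

Lemma set_dist0P A B : set_dist A B = 0%E <->
  forall e : R, 0 < e -> exists a b, [/\ A a, B b & mdist a b < e].
Proof.
split=> [AB0 e e0|h].
  have : (set_dist A B < e%:E)%E by rewrite AB0 lte_fin.
  move=> /ereal_inf_lt[_ [a Aa [b Bb <-]]]; rewrite lte_fin => ab.
  by exists a, b.
apply/eqP; rewrite eq_le; apply/andP; split.
- apply/lee_addgt0Pr => e e0; rewrite add0e.
  have [a [b [Aa Bb ab]]] := h e e0.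
  apply: le_trans (_ : (mdist a b)%:E <= _)%E; last by rewrite lee_fin ltW.
  by apply: ereal_inf_lbound; exists a => //; exists b.
- by apply: le_ereal_inf_tmp => _ [a _ [b _ <-]]; rewrite lee_fin mdist_ge0.
Qed.

Definition higson_rel A B : Prop :=
  set_dist A B = 0%E \/ metric_coarse_proximity A B.

Lemma higson_sym A B : higson_rel A B -> higson_rel B A.
Proof.
move=> [/set_dist0P h|/cprox_sym]; [left|by right].
apply/set_dist0P => e /h[a [b [? ? ab]]].
by exists b, a; split => //; rewrite metric_sym.
Qed.

Lemma higson_neq0 A B : higson_rel A B -> A !=set0 /\ B !=set0.
Proof.
move=> [/set_dist0P/(_ 1 ltr01)[a [b [? ? _]]]|/cprox_neq0//].
by split; [exists a|exists b].
Qed.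

Lemma higson_meet A B : A `&` B !=set0 -> higson_rel A B.
Proof.
move=> [x [Ax Bx]]; left; apply/set_dist0P => e e0.
by exists x, x; split => //; rewrite mdistxx.
Qed.

Lemma higson_setU A B C :
  higson_rel A (B `|` C) <-> higson_rel A B \/ higson_rel A C.
Proof.
split; last first.
  move=> [[/set_dist0P h|h]|[/set_dist0P h|h]].
  - left; apply/set_dist0P => e /h[a [b [? ? ?]]].
    by exists a, b; split => //; left.
  - by right; apply/cprox_setUr; left.
  - left; apply/set_dist0P => e /h[a [b [? ? ?]]].
    by exists a, b; split => //; right.
  - by right; apply/cprox_setUr; right.
move=> [/set_dist0P h|/cprox_setUr[h|h]]; [|by left; right|by right; right].
apply: contrapT => /not_orP[/not_orP[nB _] /not_orP[nC _]].
have aux F : set_dist A F <> 0%E -> exists2 e : R, 0 < e &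
    forall a b, A a -> F b -> ~ mdist a b < e.
  move=> nF; apply: contrapT => n; apply: nF; apply/set_dist0P => e e0.
  apply: contrapT => n'; apply: n; exists e => // a b Aa Fb ab.
  by apply: n'; exists a, b.
have [e e0 he] := aux _ nB; have [e' e'0 he'] := aux _ nC.
have [a [b [Aa Fb]]] : exists a b,
    [/\ A a, (B `|` C) b & mdist a b < Num.min e e'].
  by apply: h; rewrite lt_min e0.
rewrite lt_min => /andP[? ?].
by case: Fb => Fb; [apply: (he a b)|apply: (he' a b)].
Qed.

Lemma higson_split A B : ~ higson_rel A B ->
  exists E, ~ higson_rel A E /\ ~ higson_rel (~` E) B.
Proof.
move=> /not_orP[nd nb]; have [nAE nEB] := closer_coarse nb.
exists (closer A B); split=> -[/set_dist0P h|//]; apply: nd;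
  apply/set_dist0P => e e0; have /h : 0 < e / 2 by rewrite divr_gt0.
- move=> [a [x [Aa Ex ax]]]; have [b [Bb _ ab]] := closerP Aa Ex ax.
  by exists a, b; split => //; rewrite [e]splitr.
- move=> [x [b [Ex Bb xb]]]; have [a [Aa _ ab]] := closerCP Bb Ex xb.
  by exists a, b; split => //; rewrite [e]splitr.
Qed.

Definition higson_proximity : proximity X :=
  Proximity higson_sym higson_neq0 higson_meet higson_setU higson_split.

Lemma higson_proximity_separated : separated_proximity higson_proximity.
Proof.
move=> x y; split=> [[/set_dist0P h|/cprox_unbounded[nx _]]|->].
- apply/eqP; apply: contrapT => /negP; rewrite -mdist_gt0 => /h[_ [_ [-> ->]]].
  by rewrite ltxx.
- by case: nx; exact: bounded1.
- by apply: higson_meet; exists y.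
Qed.

Definition higson_compactification : topologicalType :=
  smirnov higson_proximity.

Definition higson_corona_set : set higson_compactification :=
  ~` range (@point_cluster X higson_proximity).

Definition higson_corona : topologicalType := set_type higson_corona_set.

End metric.

(* Main.v *)
Require Import Defs.
From mathcomp Require Import all_boot all_order all_algebra.
From mathcomp Require Import all_classical all_reals all_analysis.

(** A boundary point and a corona point are the same thing: a family of
unbounded sets.

Let [s] be a family of unbounded subsets of [X] that is a cluster for a
proximity [delta] lying between the coarse proximity [b] and the Higson
proximity; the discrete extension and the Higson proximity are the two extreme
examples ([higson_subproximity]). Deleting a bounded set from a member of [s]
leaves a member of [s]. If [A] and [B] are not [b]-near, then away from a
bounded set [D] they are at distance at least [1], so that [A] is not even
Higson-near to the part of [B] outside a neighbourhood of [D]. Hence, for a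
fixed [A], being near every member of [s] means the same for [b], for [delta]
and for the Higson proximity ([cprox_cluster_at_infinity]), and [s] satisfies
the cluster axioms for all these proximities at once
([change_proximity]).

It remains to see that the corona consists precisely of the Higson clusters
without bounded members ([higson_corona_setP]). This is where properness
enters: a bounded member has compact closure, so the cluster has a limit point
there, and a Higson cluster with a limit point is the cluster of that point.

Finally, the sets [[set s | ~ s A]] form a basis of every Smirnov
compactification ([open_notin_cluster], [smirnov_basis]). They only mention
the members of the clusters, so that the identification is a homeomorphism
([continuous_same_members]). *)

Set Implicit Arguments.
Unset Strict Implicit.
Unset Printing Implicit Defensive.
Import Order.TTheory GRing.Theory Num.Theory.
Local Open Scope classical_set_scope.
Local Open Scope ring_scope.

(** * The topology of the Smirnov compactification *)

Lemma open_notin_cluster (X : Type) (delta : proximity X) (A : set X) :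
  open [set s : smirnov delta | ~ s A].
Proof.
move=> s h /= nsA; apply: nsA; apply: cluster_max => C sC.
by apply: h => [t /= /contrapT|_ ->].
Qed.

(** If [s] is not near the complement of [O], some [A] that belongs to every
cluster outside [O] is not near some member of [s]. *)
Lemma smirnov_basis (X : Type) (delta : proximity X)
    (O : set (smirnov delta)) (s : smirnov delta) :
  open O -> O s -> exists2 A, ~ s A & [set t : smirnov delta | ~ t A] `<=` O.
Proof.
move=> oO Os.
have /not_smirnov_rel[A [C [AO Cs nAC]]] : ~ smirnov_rel (~` O) [set s].
  by move=> /oO.
exists A; first by move=> sA; apply/nAC/(cluster_near sA); exact: Cs.
by move=> t ntA; apply: contrapT => /AO.
Qed.

Lemma continuous_same_members (X : Type) (delta delta' : proximity X)
    (S : set (smirnov delta)) (T : set (smirnov delta')) (f : S -> T) :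
  (forall s A, set_val (f s) A <-> set_val s A) -> continuous f.
Proof.
move=> fE; apply/continuousP => _ [V oV <-].
exists (\bigcup_(A in [set A | [set t : smirnov delta' | ~ t A] `<=` V])
          [set s : smirnov delta | ~ s A]).
  by apply: bigcup_open => A _; exact: open_notin_cluster.
apply/seteqP; split=> s /=.
  by move=> [A AV nsA]; apply: AV => /= /fE.
by move=> /(smirnov_basis oV)[A nfsA AV]; exists A => // /fE.
Qed.

(** * Clusters at infinity *)

Section clusters_at_infinity.
Context (R : realType) (X : metricType R).
Implicit Types (A B C D : set X) (delta : proximity X).

Definition higson_subproximity delta :=
  (forall A B, metric_coarse_proximity X A B -> delta A B) /\
  (forall A B, delta A B -> higson_proximity X A B).

Lemma discrete_extension_subproximity :
  higson_subproximity (discrete_extension (metric_coarse_proximity X)).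
Proof. by split=> A B; [right|move=> [/higson_meet|]; last right]. Qed.

Lemma higson_proximity_subproximity :
  higson_subproximity (higson_proximity X).
Proof. by split=> A B //; right. Qed.

Definition at_infinity delta (s : Defs.cluster delta) :=
  forall A, s A -> ~ metric_bounded A.

Lemma at_infinity_setD delta (s : Defs.cluster delta) B D :
  at_infinity s -> metric_bounded D -> s B -> s (B `\` D).
Proof.
move=> sinfty bD; rewrite -{1}(setUIDK B D) => /cluster_setU[sBD|//].
by exfalso; apply: sinfty sBD _; apply: metric_bounded_sub bD => x [].
Qed.

(** Higson-nearness combines distance [0] and coarse nearness. One member of [s]
may well be at distance [0] from [A] without being coarsely near it, but then
it has a subset in [s] that is not Higson-near [A]. *)
Lemma cprox_cluster_at_infinity delta (s : Defs.cluster delta) A :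
  at_infinity s -> (forall B, s B -> higson_proximity X A B) ->
  forall B, s B -> metric_coarse_proximity X A B.
Proof.
move=> sinfty Anear B sB; apply: contrapT => nAB.
have [D bD AB1] : exists2 D, metric_bounded D &
    forall a b, (A `\` D) a -> (B `\` D) b -> ~ mdist a b < 1.
  apply: contrapT => n; apply: nAB; exists 1 => D bD.
  apply: contrapT => n'; apply: n; exists D => // a b Aa Bb ab.
  by apply: n'; exists a, b.
(* Once B also avoids the 1-neighbourhood of D, it is 1-far from all of A,
   including the points of A in D. *)
pose D' := D `|` [set x | exists2 y, D y & mdist x y < 1].
have bD' : metric_bounded D'.
  by apply: metric_boundedU => //; exact: metric_bounded_thicken.
case: (Anear _ (at_infinity_setD sinfty bD' sB)) => [/set_dist0P|AB].
  move=> /(_ 1 ltr01)[a [b [Aa [Bb /not_orP[nDb nD1b]] ab]]].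
  have [Da|nDa] := pselect (D a); last exact: (AB1 a b).
  by apply: nD1b; exists a => //; rewrite metric_sym.
by apply: nAB; apply: cprox_subr AB => x [].
Qed.

Section change_proximity.
Variables (delta delta' : proximity X).
Hypotheses (h : higson_subproximity delta) (h' : higson_subproximity delta').
Variables (s : Defs.cluster delta) (sinfty : at_infinity s).

Let change_near A B : s A -> s B -> delta' A B.
Proof.
move=> sA sB; apply: h'.1; apply: (cprox_cluster_at_infinity sinfty) sB => C sC.
by apply: h.2; exact: cluster_near sC.
Qed.

Let change_max A : (forall B, s B -> delta' A B) -> s A.
Proof.
move=> Anear; apply: cluster_max => B sB; apply: h.1.
by apply: (cprox_cluster_at_infinity sinfty) sB => C /Anear; exact: h'.2.
Qed.

Definition change_proximity : Defs.cluster delta' :=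
  @Cluster X delta' s change_near change_max (@cluster_setU _ _ s).

End change_proximity.

(** * Corona points are the Higson clusters at infinity *)

Lemma metric_bounded_closure A : metric_bounded A -> metric_bounded (closure A).
Proof.
move=> bA; apply: metric_bounded_sub (metric_bounded_thicken 1 bA) => x clAx.
have [y [Ay]] := clAx _ (nbhsx_ballx x 1 ltr01).
by rewrite ballEmdist => xy; exists y.
Qed.

(** A bounded member has compact closure [K]. The sets whose complement in [K]
is not in the cluster form a proper filter, and all neighbourhoods of a limit
point of this filter belong to the cluster. *)
Lemma proper_cluster_limit delta (s : Defs.cluster delta) A :
  proper_space X -> metric_bounded A -> s A ->
  exists x : X, forall V : set X, nbhs x V -> s V.
Proof.
move=> properX bA sA; set K := closure A.
have sK : s K := clusterS (@subset_closure _ A) sA.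
have cK : compact K.
  by apply: properX; [exact: closed_closure|exact: metric_bounded_closure].
have ns0 : ~ s set0 by move=> /cluster_nset0[].
pose F : set_system X := [set U | ~ s (K `\` U)].
have FF : ProperFilter F.
  split; first by rewrite /F /= setD0.
  split=> [|U V FU FV|U V UV FU].
  - by rewrite /F /= setDT.
  - by rewrite /F /= setDIr => /cluster_setU[].
  - by move=> sV; apply: FU; apply: clusterS sV; exact: setDS.
have FK : F K by rewrite /F /= setDv.
have [x [_ Fx]] := cK F FF FK.
exists x => V xV; apply: contrapT => nsV.
have FV : F (~` V).
  by move=> sKV; apply: nsV; apply: clusterS sKV => y [_ /contrapT].
by have [y [nVy Vy]] := Fx _ _ FV xV.
Qed.

Lemma higson_cluster_limit (s : Defs.cluster (higson_proximity X)) (x : X) :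
  (forall V : set X, nbhs x V -> s V) -> s = point_cluster (higson_proximity X) x.
Proof.
move=> sx; apply/point_cluster_unique/cluster_max => B sB.
left; apply/set_dist0P => e e0.
have e20 : 0 < e / 2 by rewrite divr_gt0.
have bball : metric_bounded (ball x (e / 2)).
  apply: metric_bounded_sub (metric_bounded_thicken (e / 2) (metric_bounded1 x)).
  by move=> y; rewrite ballEmdist /= metric_sym => xy; exists x.
(* A bounded ball cannot be coarsely near B, so its distance to B is 0. *)
case: (cluster_near (sx _ (nbhsx_ballx x _ e20)) sB); last first.
  by move=> /cprox_unbounded[/(_ bball)].
move=> /set_dist0P/(_ _ e20)[y [b [+ Bb yb]]]; rewrite ballEmdist /= => xy.
exists x, b; split=> //; apply: le_lt_trans (metric_triangle x y b) _.
by rewrite [ltRHS]splitr ltrD.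
Qed.

Lemma higson_corona_setP (s : higson_compactification X) :
  proper_space X -> higson_corona_set s <-> at_infinity s.
Proof.
move=> properX; split=> [nXs A sA bA|sinfty [x _ sx]].
  have [x /higson_cluster_limit sx] := proper_cluster_limit properX bA sA.
  by apply: nXs; exists x.
by move/esym/point_cluster_unique: sx => /sinfty; apply; exact: metric_bounded1.
Qed.

End clusters_at_infinity.

Theorem theorem8p4 (R : realType) (X : metricType R) :
  proper_space X ->
  homeomorphic (boundary (metric_coarse_proximity X)) (higson_corona X).
Proof.
move=> properX.
have hd := discrete_extension_subproximity X.
have hH := higson_proximity_subproximity X.
have dinf (s : boundary (metric_coarse_proximity X)) : at_infinity (set_val s).
  exact: (set_mem (valP s)).
have Hinf (s : higson_corona X) : at_infinity (set_val s).
  by apply/higson_corona_setP => //; exact: (set_mem (valP s)).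
have fP s : higson_corona_set (change_proximity hd hH (dinf s)).
  by apply/higson_corona_setP => //; exact: dinf.
have gP s : boundary_set (change_proximity hH hd (Hinf s)) by exact: Hinf.
exists (fun s => exist (fun t => t \in @higson_corona_set R X) _
                   (mem_set (fP s))),
       (fun s => exist (fun t => t \in @boundary_set X _ _) _
                   (mem_set (gP s))).
split.
- by move=> s; apply/val_inj/clusterP.
- by move=> s; apply/val_inj/clusterP.
- exact: continuous_same_members.
- exact: continuous_same_members.
Qed.
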